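(* Let $n\ge 1$, let $c\neq 0$ be a constant, and let $X$ be a random vector in $\mathbb{R}^n$ with $X\sim N(\mathbf{0},c^2\mathbf{I}_n)$. Define $\widehat{\ell}_1(X)=\ell_1(X)/\mathbb{E}(\ell_1(X))$ and $\widehat{\ell}_2(X)=\ell_2(X)/\mathbb{E}(\ell_2(X))$, where $\ell_1(X)=\|X\|_1$ and $\ell_2(X)=\|X\|_2$. Then $$\max\left\{\mathbf{Var}_X\!\left(\frac{\widehat{\ell}_2(X)}{\widehat{\ell}_1(X)}\right),\ \mathbf{Var}_X\!\left(\frac{\widehat{\ell}_1(X)}{\widehat{\ell}_2(X)}\right)\right\}\lesssim \frac{1}{n}.$$
   Context: $\mathbf{I}_n$ is the $n\times n$ identity matrix and $N(\mathbf{0},c^2\mathbf{I}_n)$ the centered isotropic Gaussian distribution. $\|\cdot\|_1$ and $\|\cdot\|_2$ are the $\ell_1$ and Euclidean norms. The symbol $A(n)\lesssim 1/n$ means that $A(n)$ is bounded above by a quantity of order $1/n$ (up to a multiplicative constant) as $n$ grows. *)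

(* Defs.v *)
From HB Require Import structures.
From mathcomp Require Import all_boot all_order all_algebra.
From mathcomp Require Import all_classical all_reals all_analysis.
Set Implicit Arguments. Unset Strict Implicit. Unset Printing Implicit Defensive.
Import Order.TTheory GRing.Theory Num.Theory.
Import numFieldNormedType.Exports.
Local Open Scope classical_set_scope.
Local Open Scope ring_scope.

(* The random vector X = (X_0,...,X_{n-1}) on the probability space P has law
   N(0, c^2 I_n): its joint law is the n-fold product of the one-dimensional
   normal law N(0,c^2), i.e. for all Borel sets B_0,...,B_{n-1},
   P(X_0 \in B_0, ..., X_{n-1} \in B_{n-1}) = prod_i N(0,c^2)(B_i).
   (Rectangles form a pi-system generating the Borel sets of R^n, so this
   determines the joint law.) *)
Definition isotropic_gaussian {R : realType} {d} {T : measurableType d}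
  (P : probability T R) (n : nat) (c : R) (X : 'I_n -> {RV P >-> R}) : Prop :=
  forall B : 'I_n -> set R, (forall i, measurable (B i)) ->
    P (\bigcap_(i in [set: 'I_n]) (X i @^-1` B i)) =
    (\prod_(i < n) normal_prob 0 c (B i))%E.

Definition ell1 {R : realType} {T : Type} (n : nat) (X : 'I_n -> T -> R) : T -> R :=
  fun w => \sum_(i < n) `|X i w|.
Definition ell2 {R : realType} {T : Type} (n : nat) (X : 'I_n -> T -> R) : T -> R :=
  fun w => Num.sqrt (\sum_(i < n) X i w ^+ 2).

Definition normalized {R : realType} {d} {T : measurableType d}
  (P : probability T R) (f : T -> R) : T -> R :=
  fun w => f w / fine ('E_P[f]).

(* Main.v *)
(** Let [U] be the empirical mean of the [|X_i|], [V] the square root of the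
    empirical mean of the [X_i^2], and [m = E|X_1|], [s^2 = E X_1^2].  Up to a
    factor between constants, the two normalized ratios are [U / V] and [V / U],
    and the variance is at most the mean squared distance to the constants
    [m / s] and [s / m].  These distances are controlled pointwise by
    [|U - m|] and [|V^2 - s^2|], whose second moments are [O(1/n)] by pairwise
    independence.  For [V / U] this fails when [U < t] for a small multiple [t]
    of [|c|]; there [(V / U)^2 <= n], and the event has probability at most
    [4^-n]: at least half of the coordinates must lie in [[-2t, 2t]].  The
    moments of the normal law are only estimated, by comparing its density
    with that of N(0, 4c^2). *)

Require Import Defs.
From HB Require Import structures.
From mathcomp Require Import all_boot all_order all_algebra.
From mathcomp Require Import all_classical all_reals all_analysis.
From mathcomp Require Import measurable_realfun ring lra zify.
Set Implicit Arguments. Unset Strict Implicit. Unset Printing Implicit Defensive.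
Import Order.TTheory GRing.Theory Num.Theory.
Import numFieldNormedType.Exports.
Local Open Scope classical_set_scope.
Local Open Scope ring_scope.

(** * The normal density: fourth moment and mass of small intervals *)

(** The Radon-Nikodym derivative and the density have the same integral over every measurable set,
    hence agree almost everywhere; change of variables then applies. *)
Lemma ge0_integral_normal_prob (R : realType) (m c : R) (f : R -> \bar R) :
  (forall x, 0 <= f x)%E -> measurable_fun [set: R] f ->
  (\int[normal_prob m c]_x f x =
   \int[lebesgue_measure]_x (f x * (normal_pdf m c x)%:E))%E.
Proof.
move=> f0 mf; have Hd := normal_prob_dominates m c.
rewrite -(Radon_Nikodym_SigmaFinite.change_of_variables Hd)//=.
have mg := measurable_int _ (Radon_Nikodym_SigmaFinite.f_integrable Hd).
apply: ae_eq_integral => //=.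
- exact: emeasurable_funM.
- apply: emeasurable_funM => //; apply/measurable_EFinP.
  exact: measurable_normal_pdf.
apply: ae_eqe_mul2l; apply: integral_ae_eq => //=.
- exact: Radon_Nikodym_SigmaFinite.f_integrable.
- by apply/measurable_EFinP; exact: measurable_normal_pdf.
- move=> E _ mE; rewrite -(Radon_Nikodym_SigmaFinite.f_integral Hd mE)//.
Qed.

(** With [y = x ^+ 2 / (8 * c ^+ 2)], the quotient of the two densities is [2 * expR (- (3 * y))]
    and [x ^+ 4 = 64 * c ^+ 4 * y ^+ 2], which leaves an inequality in [y] alone. *)
Lemma le_normal_pdf_scale (R : realType) (c x : R) : c != 0 ->
  x ^+ 4 * normal_pdf 0 c x <= 64 * c ^+ 4 * normal_pdf 0 (2 * c) x.
Proof.
move=> c0; have c20 : 2 * c != 0 by rewrite mulf_neq0.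
rewrite !normal_pdfE//.
have -> : normal_peak c = 2 * normal_peak (2 * c).
  rewrite /normal_peak.
  have -> : (2 * c) ^+ 2 * pi *+ 2 = 2 ^+ 2 * (c ^+ 2 * pi *+ 2).
    by rewrite exprMn mulrnAr mulrA.
  by rewrite (@sqrtrM _ (2 ^+ 2))// sqrtr_sqr ger0_norm// invfM mulVKf.
set k := normal_peak _.
have k0 : 0 <= k by exact: normal_peak_ge0.
rewrite /normal_fun !subr0.
set y := x ^+ 2 / (8 * c ^+ 2).
have c2 : 0 < c ^+ 2 by rewrite exprn_even_gt0.
have y0 : 0 <= y by rewrite divr_ge0 ?sqr_ge0// mulr_ge0// ltW.
have -> : - x ^+ 2 / (c ^+ 2 *+ 2) = - y + - (3 * y).
  by rewrite /y -mulr_natr; field; rewrite c0.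
have -> : - x ^+ 2 / ((2 * c) ^+ 2 *+ 2) = - y.
  by rewrite /y -mulr_natr; field; rewrite c0.
rewrite expRD.
have e0 := expR_gt0 (- y).
have -> : x ^+ 4 = 64 * c ^+ 4 * y ^+ 2 by rewrite /y; field; rewrite c0.
(* Cubing [1 + y <= expR y] suffices: the expansion of [(1 + y) ^+ 3] contains [3 * y ^+ 2]. *)
have key : 2 * y ^+ 2 * expR (- (3 * y)) <= 1.
  rewrite expRN ler_pdivrMr ?expR_gt0// mul1r.
  have := expR_ge1Dx y; have E : expR (3 * y) = expR y ^+ 3.
    by rewrite -expRM_natl mulrC.
  rewrite E => h.
  have : (1 + y) ^+ 3 <= expR y ^+ 3 by rewrite lerXn2r// nnegrE ?expR_ge0 ?addr_ge0.
  apply: le_trans.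
  have -> : (1 + y) ^+ 3 = 2 * y ^+ 2 + (1 + 3 * y + y ^+ 2 + y ^+ 3) by ring.
  have y2 : 0 <= y ^+ 2 by exact: exprn_ge0.
  have y3 : 0 <= y ^+ 3 by exact: exprn_ge0.
  rewrite lerDl; lra.
have c4 : 0 <= c ^+ 4 by rewrite exprn_even_ge0.
have -> : 64 * c ^+ 4 * y ^+ 2 * (2 * k * (expR (- y) * expR (- (3 * y)))) =
  (64 * c ^+ 4 * (k * expR (- y))) * (2 * y ^+ 2 * expR (- (3 * y))) by ring.
rewrite -[leRHS]mulr1; apply: ler_wpM2l => //; apply: mulr_ge0.
  exact: mulr_ge0.
by apply: mulr_ge0 => //; exact: ltW.
Qed.

(** Integrates the comparison of densities; the wider one has total mass 1. *)
Lemma normal_moment4_le (R : realType) (c : R) : c != 0 ->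
  (\int[normal_prob 0 c]_x (x ^+ 4)%:E <= (64 * c ^+ 4)%:E)%E.
Proof.
move=> c0; have m4 : measurable_fun [set: R] (fun x : R => x ^+ 4).
  exact: measurable_funX.
rewrite ge0_integral_normal_prob; last 2 first.
- by move=> x; rewrite lee_fin exprn_even_ge0.
- exact/measurable_EFinP.
have c4 : 0 <= 64 * c ^+ 4 by rewrite mulr_ge0// exprn_even_ge0.
have mp s : measurable_fun [set: R] (fun x => (normal_pdf 0 s x)%:E).
  by apply/measurable_EFinP; exact: measurable_normal_pdf.
have p0 s x : (0 <= (normal_pdf 0 s x)%:E :> \bar R)%E.
  by rewrite lee_fin normal_pdf_ge0.
rewrite -[leRHS]mule1 -(integral_normal_pdf 0 (2 * c)) -ge0_integralZl//=; last exact: mp.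
apply: ge0_le_integral => //=.
- by move=> x _; rewrite mule_ge0// lee_fin exprn_even_ge0.
- by apply: emeasurable_funM; [exact/measurable_EFinP|exact: mp].
- by apply: measurable_funeM; exact: mp.
- by move=> x _; rewrite -!EFinM lee_fin le_normal_pdf_scale.
Qed.

Lemma normal_prob_itv_le (R : realType) (c a : R) : c != 0 -> 0 <= a ->
  (normal_prob 0 c `[(- a)%R, a] <= (a / `|c|)%:E)%E.
Proof.
move=> c0 a0; rewrite /normal_prob.
have nc : 0 < `|c| by rewrite normr_gt0.
have pk : normal_peak c <= (2 * `|c|)^-1.
  rewrite /normal_peak lef_pV2 ?posrE ?mulr_gt0//; last first.
    by rewrite sqrtr_gt0 pmulrn_lgt0// mulr_gt0 ?exprn_even_gt0// pi_gt0.
  rewrite -[leLHS]ger0_norm ?mulr_ge0// -sqrtr_sqr ler_wsqrtr//.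
  have -> : (2 * `|c|) ^+ 2 = c ^+ 2 * 2 *+ 2.
    by rewrite exprMn real_normK ?num_real// -mulr_natr; ring.
  by rewrite lerMn2r/= ler_wpM2l ?sqr_ge0// pi_ge2.
apply: (@le_trans _ _ (\int[lebesgue_measure]_(x in `[(- a)%R, a]) cst ((2 * `|c|)^-1)%:E x)%E).
  apply: ge0_le_integral => //=.
  - by move=> x _; rewrite lee_fin normal_pdf_ge0.
  - apply/measurable_EFinP/measurable_funTS; exact: measurable_normal_pdf.
  - by move=> x _; rewrite lee_fin (le_trans _ pk)// normal_pdf_ub.
rewrite integral_cst//= lebesgue_measure_itv/= lte_fin.
have e : (2 * `|c|)^-1 * (a - - a) = a / `|c| by field; rewrite normr_eq0.
(* The second case is the degenerate interval [a = 0], of measure zero. *)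
case: ifPn => _; first by rewrite -EFinB -EFinM lee_fin e.
by rewrite mule0 lee_fin divr_ge0.
Qed.

(** * Affine majorants and the moments of the normal law *)

Lemma ge0_integral_affine d (T : measurableType d) (R : realType)
    (P : probability T R) (f : T -> R) (a b m : R) :
  measurable_fun setT f -> (forall x, 0 <= f x) -> 0 <= a -> 0 <= b ->
  (\int[P]_x (f x)%:E = m%:E)%E ->
  (\int[P]_x (a + b * f x)%:E = (a + b * m)%:E)%E.
Proof.
move=> mf f0 a0 b0 fm.
under eq_integral do rewrite EFinD EFinM.
rewrite ge0_integralD//=; last 2 first.
- by move=> x _; rewrite -EFinM lee_fin mulr_ge0.
- by apply: measurable_funeM; exact/measurable_EFinP.
have -> : (\int[P]_x a%:E = a%:E)%E.
  by rewrite integral_cst//= probability_setT mule1.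
rewrite ge0_integralZl//=; [|exact/measurable_EFinP|by move=> x _; rewrite lee_fin].
by rewrite fm -EFinM -EFinD.
Qed.

(** Stands in for the Jensen and Cauchy-Schwarz inequalities below: a tangent-line majorant turns a
    known moment into a bound on another one. *)
Lemma ge0_le_integral_affine d (T : measurableType d) (R : realType)
    (P : probability T R) (f g : T -> R) (a b m k : R) :
  measurable_fun setT f -> (forall x, 0 <= f x) -> 0 <= a -> 0 <= b ->
  (\int[P]_x (f x)%:E = m%:E)%E ->
  measurable_fun setT g -> (forall x, 0 <= g x) ->
  (forall x, g x <= a + b * f x) -> a + b * m <= k ->
  (\int[P]_x (g x)%:E <= k%:E)%E.
Proof.
move=> mf f0 a0 b0 fm mg g0 gf mk.
apply: (@le_trans _ _ (a + b * m)%:E); last by rewrite lee_fin.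
rewrite -(ge0_integral_affine mf f0 a0 b0 fm).
apply: ge0_le_integral => //=.
- by move=> x _; rewrite lee_fin.
- exact/measurable_EFinP.
- apply/measurable_EFinP; apply: measurable_funD => //.
  exact: measurable_funM.
- by move=> x _; rewrite lee_fin.
Qed.

Lemma ge0_integral_finE d (T : measurableType d) (R : realType)
    (P : probability T R) (g : T -> R) (k : R) :
  (forall x, 0 <= g x) -> (\int[P]_x (g x)%:E <= k%:E)%E ->
  exists m : R, [/\ 0 <= m, m <= k & (\int[P]_x (g x)%:E = m%:E)%E].
Proof.
move=> g0 gk.
have i0 : (0 <= \int[P]_x (g x)%:E)%E.
  by apply: integral_ge0 => x _; rewrite lee_fin.
exists (fine (\int[P]_x (g x)%:E)).
have fi : (\int[P]_x (g x)%:E)%E \is a fin_num.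
  by rewrite ge0_fin_numE// (le_lt_trans gk)// ltry.
by rewrite fine_ge0// -lee_fin fineK.
Qed.

Lemma normal_moments (R : realType) (c : R) : c != 0 -> exists m v q : R,
  [/\ (\int[normal_prob 0 c]_x `|x|%:E = m%:E)%E,
      (\int[normal_prob 0 c]_x (x ^+ 2)%:E = v%:E)%E,
      (\int[normal_prob 0 c]_x (x ^+ 4)%:E = q%:E)%E,
      `|c| / 4 <= m &
      [/\ m ^+ 2 <= v, v <= 33 * c ^+ 2 & q <= 64 * c ^+ 4]].
Proof.
move=> c0; set N := normal_prob 0 c.
have mX k : measurable_fun [set: measurableTypeR R] (fun x => x ^+ k : R).
  exact: (@measurable_funX _ (measurableTypeR R)).
have mA : measurable_fun [set: measurableTypeR R] (fun x => `|x| : R).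
  exact: measurableT_comp.
have c2 : 0 < c ^+ 2 by rewrite exprn_even_gt0.
have nc : 0 < `|c| by rewrite normr_gt0.
have X4 x : 0 <= x ^+ 4 :> R by rewrite exprn_even_ge0.
have [q [q0 qle qE]] := ge0_integral_finE (P := N) X4 (normal_moment4_le c0).
(* The majorant is the tangent in [x ^+ 4] at [x ^+ 2 = c ^+ 2]; it yields [1/2 + 32] times
   [c ^+ 2], rounded up to 33. *)
have vle : (\int[N]_x (x ^+ 2)%:E <= (33 * c ^+ 2)%:E)%E.
  apply: (@ge0_le_integral_affine _ _ _ N _ _ (c ^+ 2 / 2) ((2 * c ^+ 2)^-1) _ _ (mX 4%N) X4 _ _ qE (mX 2%N)).
  - by rewrite divr_ge0 // sqr_ge0.
  - by rewrite invr_ge0 mulr_ge0// sqr_ge0.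
  - by move=> x; rewrite sqr_ge0.
  - move=> x; rewrite -subr_ge0.
    have -> : c ^+ 2 / 2 + (2 * c ^+ 2)^-1 * x ^+ 4 - x ^+ 2 =
      (c ^+ 2 - x ^+ 2) ^+ 2 / (2 * c ^+ 2) by field; rewrite c0.
    by rewrite divr_ge0 ?sqr_ge0// mulr_ge0// sqr_ge0.
  - have -> : 33 * c ^+ 2 = c ^+ 2 / 2 + (2 * c ^+ 2)^-1 * (64 * c ^+ 4) + c ^+ 2 / 2.
      by field; rewrite c0.
    rewrite -[leLHS]addr0 lerD ?lerD2l//; last by rewrite divr_ge0 // sqr_ge0.
    by rewrite ler_wpM2l// invr_ge0 mulr_ge0// sqr_ge0.
have X2 x : 0 <= x ^+ 2 :> R by rewrite sqr_ge0.
have [v [v0 v33 vE]] := ge0_integral_finE (P := N) X2 vle.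
have sq (y : R) : y <= 1 + 1 * y ^+ 2.
  rewrite -subr_ge0.
  have -> : 1 + 1 * y ^+ 2 - y = (y - 2^-1) ^+ 2 + 3 / 4 by field.
  by rewrite addr_ge0 ?sqr_ge0// divr_ge0.
(* This bound only serves to make the first moment a real number [m]. *)
have mle : (\int[N]_x `|x|%:E <= (1 + 1 * v)%:E)%E.
  apply: (@ge0_le_integral_affine _ _ _ N _ _ 1 1 _ _ (mX 2%N) X2 _ _ vE mA) => //.
  by move=> x; have := sq `|x|; rewrite (real_normK (num_real x)).
have A0 (x : R) : 0 <= `|x| by exact: normr_ge0.
have [m [m0 _ mE]] := ge0_integral_finE (P := N) A0 mle.
exists m, v, q; split => //; last split => //.
(* Markov's inequality: [I] has mass at most 1/2, and off [I] the absolute value exceeds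
   [|c| / 2]. *)
- pose I : set (measurableTypeR R) := `[(- (`|c| / 2))%R, (`|c| / 2)%R]%classic.
  have mI : measurable I by exact: measurable_itv.
  have hI : (N I <= 2^-1%:E)%E.
    have -> : 2^-1 = `|c| / 2 / `|c| by field; rewrite normr_eq0.
    by apply: normal_prob_itv_le => //; rewrite divr_ge0.
  rewrite -lee_fin -mE.
  apply: (@le_trans _ _ ((`|c| / 2)%:E * N (~` I))%E).
    have -> : N (~` I) = (1 - N I)%E by exact: probability_setC.
    have fI : N I \is a fin_num by exact: fin_num_measure.
    move: hI; rewrite -(fineK fI) lee_fin => hI.
    rewrite -EFinB -EFinM lee_fin.
    have : 0 <= `|c| / 2 * (2^-1 - fine (N I)) by rewrite mulr_ge0 ?divr_ge0 // subr_ge0.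
    lra.
  have <- : (\int[N]_x (\1_(~` I) x)%:E = N (~` I))%E.
    by rewrite integral_indic ?setIT//; exact: measurableC.
  have mC : measurable (~` I) by exact: measurableC.
  rewrite -ge0_integralZl//=; last first.
    by apply/measurable_EFinP; exact: measurable_indic.
  apply: ge0_le_integral => //=.
  + by apply: measurable_funeM; apply/measurable_EFinP; exact: measurable_indic.
  + exact/measurable_EFinP.
  + move=> x _; rewrite -EFinM lee_fin indicE.
    case: (boolP (x \in ~` I)); last by rewrite mulr0.
    rewrite inE /I /= in_itv/= mulr1 -ler_norml => /negP.
    by rewrite -ltNge => /ltW.
(* Integrating [2 * m * |x| <= m ^+ 2 + x ^+ 2] gives [2 * m ^+ 2 <= m ^+ 2 + v]. *)
- have : (\int[N]_x (0 + (2 * m) * `|x|)%:E <= (m ^+ 2 + 1 * v)%:E)%E.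
    apply: (@ge0_le_integral_affine _ _ _ N _ _ (m ^+ 2) 1 _ _ (mX 2%N) X2 _ _ vE) => //.
    + by apply: measurable_funD => //; exact: measurable_funM.
    + by move=> x; rewrite add0r !mulr_ge0.
    + move=> x; rewrite -(real_normK (num_real x)) -subr_ge0.
      have -> : m ^+ 2 + 1 * `|x| ^+ 2 - (0 + 2 * m * `|x|) = (m - `|x|) ^+ 2 by ring.
      exact: sqr_ge0.
  rewrite (ge0_integral_affine mA A0 (lexx 0) _ mE) ?mulr_ge0// lee_fin.
  rewrite expr2; lra.
Qed.

(** * Independent identically distributed families and their empirical means *)

(** The rectangle condition of [isotropic_gaussian] with an arbitrary marginal [Q], so that the
    Gaussian hypothesis is directly an instance. *)
Definition iid_law (R : realType) d (T : measurableType d) d'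
    (E : measurableType d') (P : probability T R) (Q : probability E R)
    (n : nat) (X : 'I_n -> T -> E) : Prop :=
  forall B : 'I_n -> set E, (forall i, measurable (B i)) ->
    P (\bigcap_(i in [set: 'I_n]) (X i @^-1` B i)) =
    (\prod_(i < n) Q (B i))%E.

Section iid.
Context (R : realType) d (T : measurableType d) d' (E : measurableType d').
Context (P : probability T R) (Q : probability E R).
Context (n : nat) (X : 'I_n -> T -> E).
Context (mX : forall i, measurable_fun setT (X i)) (iidX : iid_law P Q X).

(** Indices outside [S] receive the full set, whose [Q]-mass is 1. *)
Lemma iid_bigcap (S : {set 'I_n}) (B : 'I_n -> set E) :
  (forall i, measurable (B i)) ->
  P (\bigcap_(i in [set i | i \in S]) (X i @^-1` B i)) =
  (\prod_(i in S) Q (B i))%E.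
Proof.
move=> mB; pose B' i := if i \in S then B i else setT.
have -> : \bigcap_(i in [set i | i \in S]) (X i @^-1` B i) =
          \bigcap_(i in [set: 'I_n]) (X i @^-1` B' i).
  apply/seteqP; split=> w /= h i /= iS.
    by rewrite /B'; case: ifPn => // iS'; exact: h.
  by have := h i I; rewrite /B' iS.
rewrite iidX; last by move=> i; rewrite /B'; case: ifP.
rewrite [RHS]big_mkcond; apply: eq_bigr => i _; rewrite /B'.
by case: ifP => // _; rewrite probability_setT.
Qed.

Lemma iid_preimage i (A : set E) : measurable A -> P (X i @^-1` A) = Q A.
Proof.
move=> mA; have := @iid_bigcap [set i]%SET (fun=> A) (fun=> mA).
rewrite big_set1 => <-; congr (P _).
apply/seteqP; split=> w /= h.
  by move=> j /=; rewrite inE => /eqP ->.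
by apply: (h i); rewrite /= inE.
Qed.

Lemma iid_preimage2 i j (A B : set E) : i != j -> measurable A ->
  measurable B -> P (X i @^-1` A `&` X j @^-1` B) = (Q A * Q B)%E.
Proof.
move=> ij mA mB.
have := @iid_bigcap [set i; j]%SET (fun k => if k == i then A else B).
rewrite big_setU1 ?inE//= big_set1 eqxx eq_sym (negbTE ij) => <-; last first.
  by move=> k; case: ifP.
congr (P _); apply/seteqP; split=> w /= h.
  move=> k /=; rewrite !inE; case: (eqVneq k i) => [-> _|_ /= /eqP ->].
    by case: h.
  by case: h.
split.
  by have := h i; rewrite /= !inE eqxx => /(_ isT).
by have := h j; rewrite /= !inE eqxx orbT eq_sym (negbTE ij) => /(_ isT).
Qed.

Lemma iid_ge0_integral i (f : E -> \bar R) : measurable_fun setT f ->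
  (forall x, 0 <= f x)%E -> (\int[P]_w f (X i w) = \int[Q]_x f x)%E.
Proof.
move=> mf f0; transitivity (\int[pushforward P (X i)]_x f x)%E.
  by rewrite ge0_integral_pushforward.
by apply: eq_measure_integral => A mA _; exact: iid_preimage.
Qed.

(** The law of the pair agrees with the product measure on rectangles, hence equals it; Tonelli's
    theorem then factors the integral. *)
Lemma iid_ge0_integralM i j (f : E -> \bar R) : i != j ->
  measurable_fun setT f -> (forall x, 0 <= f x)%E ->
  (\int[P]_w (f (X i w) * f (X j w)) =
   (\int[Q]_x f x) * (\int[Q]_x f x))%E.
Proof.
move=> ij mf f0.
pose Z w := (X i w, X j w).
have mZ : measurable_fun setT Z by exact: measurable_fun_pair.
pose g (z : E * E) := (f z.1 * f z.2)%E.
have mg : measurable_fun setT g.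
  by apply: emeasurable_funM; exact: measurableT_comp.
have g0 z : (0 <= g z)%E by exact: mule_ge0.
transitivity (\int[pushforward P Z]_z g z)%E.
  by rewrite ge0_integral_pushforward.
transitivity (\int[Q \x Q]_z g z)%E.
  apply: eq_measure_integral => A mA _; apply/esym.
  apply: (@product_measure_unique _ _ _ _ _ Q Q (pushforward P Z)) => // B C mB mC.
  by rewrite -(iid_preimage2 ij).
rewrite fubini_tonelli1//= /fubini_F /g/=.
under eq_integral do rewrite ge0_integralZl//.
by rewrite ge0_integralZr//; exact: integral_ge0.
Qed.

Lemma iid_ge0_integral_sum (f : E -> R) (m : R) :
  measurable_fun setT f -> (forall x, 0 <= f x) ->
  (\int[Q]_x (f x)%:E = m%:E)%E ->
  (\int[P]_w (\sum_(i < n) f (X i w))%:E = (n%:R * m)%:E)%E.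
Proof.
move=> mf f0 fm.
have mfX i : measurable_fun setT (fun w => f (X i w)) by exact: measurableT_comp.
have EX i : (\int[P]_w (f (X i w))%:E = m%:E)%E.
  rewrite -fm -(@iid_ge0_integral i (EFin \o f))//.
  exact/measurable_EFinP.
under eq_integral do rewrite -sumEFin.
rewrite ge0_integral_sum//=; last 2 first.
- by move=> i; apply/measurable_EFinP.
- by move=> i x _; rewrite lee_fin.
under eq_bigr do rewrite EX.
by rewrite sumEFin sumr_const card_ord -[RHS]/((n%:R * m)%:E) mulr_natl.
Qed.

(** The left side is the variance of an empirical mean, [(q - m ^+ 2) / n], by pairwise
    independence. *)
Lemma iid_mean_deviation_le (f : E -> R) (m q : R) : (0 < n)%N ->
  measurable_fun setT f -> (forall x, 0 <= f x) ->
  (\int[Q]_x (f x)%:E = m%:E)%E -> (\int[Q]_x (f x ^+ 2)%:E = q%:E)%E ->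
  (\int[P]_w (((\sum_(i < n) f (X i w)) / n%:R - m) ^+ 2)%:E <= (q / n%:R)%:E)%E.
Proof.
move=> n0 mf f0 fm fq.
have n0' : 0 < n%:R :> R by rewrite ltr0n.
have m0 : 0 <= m.
  by rewrite -lee_fin -fm; apply: integral_ge0 => x _; rewrite lee_fin.
have mfX i : measurable_fun setT (fun w => f (X i w)) by exact: measurableT_comp.
have mS : measurable_fun setT (fun w => \sum_(i < n) f (X i w)).
  exact: measurable_sum.
have S0 w : 0 <= \sum_(i < n) f (X i w) by exact: sumr_ge0.
have ES := iid_ge0_integral_sum mf f0 fm.
have ES2 : (\int[P]_w ((\sum_(i < n) f (X i w)) ^+ 2)%:E =
    (n%:R * q + n%:R * (n%:R - 1) * m ^+ 2)%:E)%E.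
  under eq_integral do rewrite expr2 mulr_suml -sumEFin.
  rewrite ge0_integral_sum//=; last 2 first.
  - by move=> i; apply/measurable_EFinP; exact: measurable_funM.
  - by move=> i x _; rewrite lee_fin mulr_ge0.
  (* One diagonal term contributes [q], each of the [n - 1] others [m ^+ 2]. *)
  have row i : (\int[P]_w (f (X i w) * \sum_(j < n) f (X j w))%:E =
      (q + (n%:R - 1) * m ^+ 2)%:E)%E.
    under eq_integral do rewrite mulr_sumr -sumEFin.
    rewrite ge0_integral_sum//=; last 2 first.
    - by move=> j; apply/measurable_EFinP; exact: measurable_funM.
    - by move=> j x _; rewrite lee_fin mulr_ge0.
    rewrite (bigD1 i)//=.
    have -> : (\int[P]_w (f (X i w) * f (X i w))%:E = q%:E)%E.
      rewrite -fq -(@iid_ge0_integral i (fun x => (f x ^+ 2)%:E))//.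
        by apply/measurable_EFinP; exact: measurable_funX.
      by move=> x; rewrite lee_fin sqr_ge0.
    rewrite (eq_bigr (fun=> (m ^+ 2)%:E)); last first.
      move=> j ji; under eq_integral do rewrite EFinM.
      rewrite (@iid_ge0_integralM i j (EFin \o f)) 1?eq_sym//.
      - by rewrite /= fm -EFinM.
      - exact/measurable_EFinP.
    rewrite sumEFin -EFinD big_const cardC1 card_ord iter_addr_0.
    by rewrite -[(m ^+ 2) *+ _]mulr_natl -subn1 natrB.
  under eq_bigr do rewrite row.
  rewrite sumEFin sumr_const card_ord -[in LHS]mulr_natl.
  by congr (_%:E); ring.
pose U w := (\sum_(i < n) f (X i w)) / n%:R.
have mU : measurable_fun setT U by exact: measurable_funM.
have U0 w : 0 <= U w by rewrite divr_ge0.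
have EU : (\int[P]_w (U w)%:E = m%:E)%E.
  have := ge0_integral_affine mS S0 (lexx 0) _ ES (b := n%:R^-1).
  under eq_integral do rewrite add0r mulrC.
  move=> -> ; first by congr (_%:E); field; rewrite gt_eqF.
  by rewrite invr_ge0.
have mS2 : measurable_fun setT (fun w => (\sum_(i < n) f (X i w)) ^+ 2).
  exact: measurable_funX.
have S20 w : 0 <= (\sum_(i < n) f (X i w)) ^+ 2 by exact: sqr_ge0.
have mD : measurable_fun setT (fun w => (U w - m) ^+ 2).
  by apply: measurable_funX; exact: measurable_funB.
(* The cross term of the square is moved to the left, so that only nonnegative functions are
   integrated. *)
have key : ((\int[P]_w ((U w - m) ^+ 2)%:E) + (2 * m * m)%:E =
    (m ^+ 2 + (q + (n%:R - 1) * m ^+ 2) / n%:R)%:E)%E.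
  have <- : (\int[P]_w (0 + 2 * m * U w)%:E = (2 * m * m)%:E)%E.
    by rewrite (ge0_integral_affine mU U0 _ _ EU) ?mulr_ge0// add0r.
  rewrite -ge0_integralD//=; last 4 first.
  - by move=> w _; rewrite lee_fin sqr_ge0.
  - exact/measurable_EFinP.
  - by move=> w _; rewrite lee_fin add0r !mulr_ge0.
  - by apply/measurable_EFinP; apply: measurable_funD => //; exact: measurable_funM.
  have := ge0_integral_affine mS2 S20 (sqr_ge0 m) _ ES2 (b := n%:R^-2).
  rewrite invr_ge0 exprn_ge0// => /(_ isT) e.
  transitivity (\int[P]_w (m ^+ 2 + n%:R ^- 2 * (\sum_(i < n) f (X i w)) ^+ 2)%:E)%E.
    apply: eq_integral => w _; rewrite -EFinD /U; congr (_%:E); field.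
    by rewrite gt_eqF.
  by rewrite e; congr (_%:E); field; rewrite gt_eqF.
have D0 w : 0 <= (U w - m) ^+ 2 by exact: sqr_ge0.
(* Finiteness turns [key] into an equation between reals, which is solved for the integral. *)
have [|k [_ _ kE]] := @ge0_integral_finE _ _ _ P _
    (m ^+ 2 + (q + (n%:R - 1) * m ^+ 2) / n%:R) D0.
  by rewrite -key leeDl// lee_fin !mulr_ge0.
rewrite kE lee_fin; move: key; rewrite kE -EFinD => -[key].
have -> : k = (q - m ^+ 2) / n%:R.
  by apply: (addIr (2 * m * m)); rewrite key; field; rewrite gt_eqF.
by rewrite ler_pM2r ?invr_gt0// gerBl sqr_ge0.
Qed.

End iid.

(** * Exponentially small lower tail of an empirical mean *)

Lemma measure_bigsetU_fin_le d (T : measurableType d) (R : realType)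
    (mu : {measure set T -> \bar R}) (I : finType) (p : pred I)
    (F : I -> set T) : (forall i, measurable (F i)) ->
  measurable (\big[setU/set0]_(i | p i) F i) /\
  (mu (\big[setU/set0]_(i | p i) F i) <= \sum_(i | p i) mu (F i))%E.
Proof.
move=> mF; apply: (@big_rec2 _ _ (fun A y => measurable A /\ (mu A <= y)%E)).
  by rewrite measure0.
move=> i y A _ [mA Ay]; split; first exact: measurableU.
by apply: (le_trans (measureU2 mu (mF i) mA)); exact: leeD2l.
Qed.

(* If the mean is below t then at least half of the summands are at most 2t;
   union bound over the sets S of such indices. *)
Lemma iid_mean_lt_le (R : realType) d (T : measurableType d) d'
    (E : measurableType d') (P : probability T R) (Q : probability E R)
    (n : nat) (X : 'I_n -> T -> E) (g : E -> R) (t delta : R) :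
  (forall i, measurable_fun setT (X i)) -> iid_law P Q X ->
  measurable_fun setT g -> (forall x, 0 <= g x) -> 0 <= t ->
  0 <= delta <= 1 ->
  (Q [set x | (g x <= 2 * t)%R] <= (delta ^+ 2)%:E)%E ->
  (P [set w | (\sum_(i < n) g (X i w) < n%:R * t)%R] <= ((2 * delta) ^+ n)%:E)%E.
Proof.
move=> mX iidX mg g0 t0 /andP[d0 d1] Qle.
pose B : set E := [set x | g x <= 2 * t].
have mB : measurable B.
  have -> : B = setT `&` g @^-1` `]-oo, (2 * t)%R].
    by rewrite setTI; apply/seteqP; split=> x /=; rewrite in_itv.
  exact: mg.
pose F (S : {set 'I_n}) := \bigcap_(i in [set i | i \in S]) (X i @^-1` B).
have mF S : measurable (F S).
  apply: fin_bigcap_measurable; first exact: finite_finset.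
  by move=> i _; rewrite -[_ @^-1` _]setTI; exact: mX.
have [mU Ule] := measure_bigsetU_fin_le P (fun S : {set 'I_n} => (n <= 2 * #|S|)%N) mF.
(* The mass is at most [delta ^+ (2 * #|S|)]; since [delta <= 1], lowering the exponent to [n]
   weakens the bound. *)
have PF (S : {set 'I_n}) : (n <= 2 * #|S|)%N -> (P (F S) <= (delta ^+ n)%:E)%E.
  move=> nS; rewrite (@iid_bigcap _ _ _ _ _ _ _ _ _ iidX _ (fun=> B))//.
  have fQ : Q B \is a fin_num by exact: fin_num_measure.
  have Q0 : 0 <= fine (Q B) by exact: fine_ge0.
  have Q1 : fine (Q B) <= delta ^+ 2 by rewrite -lee_fin fineK.
  rewrite -(fineK fQ) prodEFin lee_fin prodr_const.
  apply: (@le_trans _ _ ((delta ^+ 2) ^+ #|S|)).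
    by rewrite lerXn2r// nnegrE ?exprn_ge0.
  by rewrite -exprM ler_wiXn2l.
have sub : [set w | \sum_(i < n) g (X i w) < n%:R * t] `<=`
    \big[setU/set0]_(S : {set 'I_n} | (n <= 2 * #|S|)%N) F S.
  move=> w /= small; pose S : {set 'I_n} := finset (fun i => g (X i w) <= 2 * t).
  have [nS|nS] := leqP n (2 * #|S|).
    by rewrite (bigD1 S)//=; left => i /=; rewrite inE.
  (* Otherwise at least half of the summands exceed [2 * t], and these alone sum to at least
     [n * t]. *)
  exfalso; move: small; rewrite ltNge => /negP; apply.
  apply: (@le_trans _ _ (\sum_(i in ~: S) 2 * t)).
    rewrite sumr_const -[leRHS]mulr_natl mulrA ler_wpM2r// -natrM ler_nat.
    have := cardsC S; rewrite card_ord; lia.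
  rewrite [leRHS](bigID (mem (~: S)%SET)) /= -[leLHS]addr0 lerD ?sumr_ge0//.
  by apply: ler_sum => i; rewrite !inE -ltNge => /ltW.
apply: (le_trans (le_measure _ _ _ sub)); rewrite ?inE//.
  have -> : [set w | \sum_(i < n) g (X i w) < n%:R * t] =
     setT `&` (fun w => \sum_(i < n) g (X i w)) @^-1` `]-oo, (n%:R * t)%R[.
    by rewrite setTI; apply/seteqP; split=> x /=; rewrite in_itv.
  apply: measurable_sum => // i; exact: measurableT_comp.
apply: (le_trans Ule).
apply: (@le_trans _ _ (\sum_(S : {set 'I_n} | (n <= 2 * #|S|)%N) (delta ^+ n)%:E)%E).
  exact: lee_sum.
(* Summing over all [2 ^ n] subsets produces the factor 2 in [2 * delta]. *)
apply: (@le_trans _ _ (\sum_(S : {set 'I_n}) (delta ^+ n)%:E)%E).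
  rewrite big_mkcond; apply: lee_sum => S _; case: ifP => // _.
  by rewrite lee_fin exprn_ge0.
rewrite sumEFin sumr_const -cardsT -powersetT card_powerset cardsT card_ord.
by rewrite lee_fin exprMn -[leLHS]mulr_natl natrX.
Qed.

(** * Bounding a variance by integrals *)

(** Variance is invariant under the shift [g = f - a], and that of [g] is its second moment minus a
    square. The bound [M] provides integrability. *)
Lemma variance_le_integral_sqr d (T : measurableType d) (R : realType)
    (P : probability T R) (f : T -> R) (a M : R) :
  measurable_fun setT f -> (forall w, `|f w| <= M) ->
  ('V_P[f] <= \int[P]_w ((f w - a) ^+ 2)%:E)%E.
Proof.
move=> mf fM.
have int (h : T -> R) K : measurable_fun setT h -> (forall w, `|h w| <= K) ->
    h \in Lfun P 1.
  move=> mh hK; apply/Lfun1_integrable.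
  apply: measurable_bounded_integrable => //.
    by rewrite -ge0_fin_numE//; exact: fin_num_measure.
  exists K; split; first exact: num_real.
  by move=> x Kx w _ /=; exact: (le_trans (hK w) (ltW Kx)).
pose g := (f \- cst a)%R.
have mg : measurable_fun setT g by exact: measurable_funB.
have gM w : `|g w| <= M + `|a|.
  by rewrite (le_trans (ler_normB _ _))// lerD.
have f1 := int _ _ mf fM.
have g1 := int _ _ mg gM.
have gg1 : (g * g)%R \in Lfun P 1.
  apply: (int _ ((M + `|a|) * (M + `|a|))); first exact: measurable_funM.
  by move=> w; rewrite normrM ler_pM.
have -> : 'V_P[f] = 'V_P[g].
  rewrite /variance unlock; congr expectation; apply/funext => w.
  have -> : fine 'E_P[g] = fine 'E_P[f] - a.
    rewrite expectationB ?Lfun_cst// expectation_cst fineB// expectation_fin_num//.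
  by rewrite !fctE /g/=; congr (_ * _); ring.
rewrite /variance covarianceE//.
have eg := expectation_fin_num g1.
apply: (@le_trans _ _ 'E_P[g * g]%E).
  by rewrite -(fineK eg) leeBlDr// leeDl// -EFinM lee_fin -expr2 sqr_ge0.
by rewrite unlock.
Qed.

Lemma ge0_le_integral_comb d (T : measurableType d) (R : realType)
    (P : probability T R) (f1 f2 g : T -> R) (a b k1 k2 : R) :
  measurable_fun setT f1 -> measurable_fun setT f2 -> measurable_fun setT g ->
  (forall w, 0 <= f1 w) -> (forall w, 0 <= f2 w) -> (forall w, 0 <= g w) ->
  0 <= a -> 0 <= b -> (forall w, g w <= a * f1 w + b * f2 w) ->
  (\int[P]_w (f1 w)%:E <= k1%:E)%E -> (\int[P]_w (f2 w)%:E <= k2%:E)%E ->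
  (\int[P]_w (g w)%:E <= (a * k1 + b * k2)%:E)%E.
Proof.
move=> mf1 mf2 mg f10 f20 g0 a0 b0 gle fk1 fk2.
apply: (@le_trans _ _ (\int[P]_w (a%:E * (f1 w)%:E + b%:E * (f2 w)%:E))%E).
  apply: ge0_le_integral => //=.
  - by move=> w _; rewrite lee_fin.
  - exact/measurable_EFinP.
  - by apply: emeasurable_funD; apply: measurable_funeM; exact/measurable_EFinP.
  - by move=> w _; rewrite -!EFinM -EFinD lee_fin.
rewrite ge0_integralD//=; last 4 first.
- by move=> w _; rewrite -EFinM lee_fin mulr_ge0.
- by apply: measurable_funeM; exact/measurable_EFinP.
- by move=> w _; rewrite -EFinM lee_fin mulr_ge0.
- by apply: measurable_funeM; exact/measurable_EFinP.
rewrite !ge0_integralZl//=;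
  do ?[exact/measurable_EFinP | by move=> w _; rewrite lee_fin].
by rewrite EFinD !EFinM leeD// lee_wpmul2l.
Qed.

(** * Pointwise inequalities for the ratios and the norms *)

(** Split [U / V - m / s] into [U / V * ((s - V) / s)] and [(U - m) / s], and use that the square of
    a sum is at most twice the sum of squares. As [U / V <= 1 <= (V + s) / s], the deviation of [V]
    passes to that of [V ^+ 2]. *)
Lemma sqr_mean_ratio_le (R : realType) (U V m s : R) :
  0 <= U -> U <= V -> 0 <= m -> m <= s -> 0 < s ->
  (U / V - m / s) ^+ 2 <=
  2 / s ^+ 4 * (V ^+ 2 - s ^+ 2) ^+ 2 + 2 / s ^+ 2 * (U - m) ^+ 2.
Proof.
move=> U0 UV m0 ms s0; have V0 := le_trans U0 UV.
have sn0 : s != 0 by rewrite gt_eqF.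
(* If [V = 0], then [U / V] is 0 by convention; the first term on the right is 2, while
   [(m / s) ^+ 2 <= 1]. *)
have [V00|Vn0] := eqVneq V 0.
  have U00 : U = 0 by apply/eqP; rewrite eq_le U0 -V00 UV.
  rewrite V00 U00 mul0r !sub0r sqrrN expr0n/= sub0r !sqrrN.
  have -> : 2 / s ^+ 4 * (s ^+ 2) ^+ 2 = 2 by field.
  have r0 : 0 <= m / s by rewrite divr_ge0// ltW.
  have r1 : m / s <= 1 by rewrite ler_pdivrMr// mul1r.
  have : (m / s) ^+ 2 <= 1 by rewrite exprn_ile1.
  have : 0 <= 2 / s ^+ 2 * m ^+ 2 by rewrite mulr_ge0 ?sqr_ge0// divr_ge0// sqr_ge0.
  lra.
have Vp : 0 < V by rewrite lt_neqAle eq_sym Vn0.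
pose a := U / V * ((s - V) / s); pose b := (U - m) / s.
have -> : U / V - m / s = a + b by rewrite /a /b; field; rewrite ?Vn0 ?sn0.
have hb : 2 / s ^+ 2 * (U - m) ^+ 2 = 2 * b ^+ 2 by rewrite /b; field.
have ha : a ^+ 2 <= (V ^+ 2 - s ^+ 2) ^+ 2 / s ^+ 4.
  have -> : (V ^+ 2 - s ^+ 2) ^+ 2 / s ^+ 4 = ((V + s) / s) ^+ 2 * ((s - V) / s) ^+ 2 by field.
  rewrite /a exprMn ler_wpM2r ?sqr_ge0//.
  rewrite lerXn2r ?nnegrE ?divr_ge0 ?addr_ge0 ?(ltW s0)//.
  apply: (@le_trans _ _ 1); first by rewrite ler_pdivrMr ?mul1r.
  by rewrite ler_pdivlMr// mul1r lerDr.
have -> : 2 / s ^+ 4 * (V ^+ 2 - s ^+ 2) ^+ 2 = 2 * ((V ^+ 2 - s ^+ 2) ^+ 2 / s ^+ 4).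
  by field.
rewrite hb; have := sqr_ge0 (a - b); move: ha.
move: ((V ^+ 2 - s ^+ 2) ^+ 2 / s ^+ 4) a b {hb} => z a b.
rewrite sqrrB sqrrD; lra.
Qed.

(** Split into [(V - s) / U] and [s * (m - U) / (U * m)]; the lower bound [t] on [U] controls both
    denominators. *)
Lemma sqr_inv_mean_ratio_le (R : realType) (U V m s t : R) :
  0 <= V -> 0 < m -> 0 < s -> 0 < t -> t <= U ->
  (V / U - s / m) ^+ 2 <=
  2 / (s ^+ 2 * t ^+ 2) * (V ^+ 2 - s ^+ 2) ^+ 2 +
  2 * s ^+ 2 / (t ^+ 2 * m ^+ 2) * (U - m) ^+ 2.
Proof.
move=> V0 m0 s0 t0 tU; have U0 := lt_le_trans t0 tU.
have [sn mn Un tn] : [/\ s != 0, m != 0, U != 0 & t != 0] by rewrite !gt_eqF.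
have r0 : 0 <= t / U by rewrite divr_ge0 ?ltW.
have r1 : t / U <= 1 by rewrite ler_pdivrMr ?mul1r.
have ru : (t / U) ^+ 2 <= 1 by rewrite exprn_ile1.
pose a := (V - s) / U; pose b := s * (m - U) / (U * m).
have -> : V / U - s / m = a + b by rewrite /a /b; field; rewrite ?sn ?mn ?Un ?tn.
have ha : a ^+ 2 <= (V ^+ 2 - s ^+ 2) ^+ 2 / (s ^+ 2 * t ^+ 2).
  have -> : (V ^+ 2 - s ^+ 2) ^+ 2 / (s ^+ 2 * t ^+ 2) =
     ((V + s) / s) ^+ 2 * ((V - s) / t) ^+ 2 by field; rewrite ?sn ?mn ?Un ?tn.
  have -> : a ^+ 2 = (t / U) ^+ 2 * ((V - s) / t) ^+ 2 by rewrite /a; field; rewrite ?sn ?mn ?Un ?tn.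
  rewrite ler_wpM2r ?sqr_ge0// (le_trans ru)//.
  by rewrite exprn_ege1// ler_pdivlMr// mul1r lerDr.
have hb : b ^+ 2 <= s ^+ 2 / (t ^+ 2 * m ^+ 2) * (U - m) ^+ 2.
  have -> : b ^+ 2 = (t / U) ^+ 2 * (s ^+ 2 / (t ^+ 2 * m ^+ 2) * (U - m) ^+ 2).
    by rewrite /b; field; rewrite ?sn ?mn ?Un ?tn.
  rewrite ler_piMl// mulr_ge0 ?sqr_ge0// divr_ge0 ?sqr_ge0//.
  by rewrite mulr_ge0 ?sqr_ge0.
have -> : 2 / (s ^+ 2 * t ^+ 2) * (V ^+ 2 - s ^+ 2) ^+ 2 =
  2 * ((V ^+ 2 - s ^+ 2) ^+ 2 / (s ^+ 2 * t ^+ 2)) by field; rewrite ?sn ?mn ?Un ?tn.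
have -> : 2 * s ^+ 2 / (t ^+ 2 * m ^+ 2) * (U - m) ^+ 2 =
  2 * (s ^+ 2 / (t ^+ 2 * m ^+ 2) * (U - m) ^+ 2) by field; rewrite ?sn ?mn ?Un ?tn.
have := sqr_ge0 (a - b); move: ha hb.
move: (_ / (s ^+ 2 * _)) (_ * (U - m) ^+ 2) a b => z y a b.
rewrite sqrrB sqrrD; lra.
Qed.

(** A difference of nonnegative reals is at most the larger one in absolute value, and both [k] and
    [s / m] are at least 1. It serves where [U] is too small, with [r = V / U] and [k = n]. *)
Lemma sqr_inv_mean_ratio_le_crude (R : realType) (r m s k : R) :
  0 <= r -> r ^+ 2 <= k -> 1 <= k -> 0 < m -> m <= s ->
  (r - s / m) ^+ 2 <= k * (s ^+ 2 / m ^+ 2).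
Proof.
move=> r0 rk k1 m0 ms.
have q1 : 1 <= s / m by rewrite ler_pdivlMr ?mul1r.
have -> : s ^+ 2 / m ^+ 2 = (s / m) ^+ 2 by rewrite expr_div_n.
move: (s / m) q1 => y y1.
have y2 : 1 <= y ^+ 2 by rewrite exprn_ege1.
have [ry|yr] := leP r y.
  apply: (@le_trans _ _ (y ^+ 2)).
    rewrite -[leLHS]sqrrN opprB lerXn2r ?nnegrE ?subr_ge0//.
      exact: le_trans y1.
    by rewrite gerBl.
  by rewrite ler_peMl// (le_trans _ y2).
apply: (@le_trans _ _ (r ^+ 2)).
  have ry : 0 <= r - y by rewrite subr_ge0 ltW.
  by rewrite lerXn2r ?nnegrE// gerBl (le_trans _ y1).
by rewrite (le_trans rk)// ler_peMr// (le_trans _ k1).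
Qed.

(** Cauchy-Schwarz, read off from the nonnegativity of the empirical variance of the absolute
    values. *)
Lemma sqr_sum_norm_le (R : realType) (n : nat) (x : 'I_n -> R) :
  (\sum_i `|x i|) ^+ 2 <= n%:R * \sum_i x i ^+ 2.
Proof.
case: n x => [|n] x; first by rewrite !big_ord0 expr0n mul0r.
pose S := \sum_i `|x i|; pose N : R := n.+1%:R.
have N0 : 0 < N by rewrite ltr0n.
have : 0 <= \sum_i (`|x i| - S / N) ^+ 2 by apply: sumr_ge0 => i _; exact: sqr_ge0.
have -> : \sum_i (`|x i| - S / N) ^+ 2 = \sum_i x i ^+ 2 - S ^+ 2 / N.
  under eq_bigr do rewrite sqrrB real_normK ?num_real//.
  rewrite big_split/= sumr_const card_ord sumrB.
  have -> : \sum_i `|x i| * (S / N) *+ 2 = S * (S / N) *+ 2.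
    by rewrite sumrMnl -mulr_suml.
  rewrite -[_ *+ n.+1]mulr_natl -/N -mulr_natr.
  by field; rewrite gt_eqF.
by rewrite subr_ge0 ler_pdivrMr// mulrC.
Qed.

Lemma sum_sqr_le (R : realType) (n : nat) (x : 'I_n -> R) :
  \sum_i x i ^+ 2 <= (\sum_i `|x i|) ^+ 2.
Proof.
rewrite [leRHS]expr2 mulr_suml; apply: ler_sum => i _.
rewrite -(real_normK (num_real (x i))) expr2 ler_wpM2l// (bigD1 i)//=.
by rewrite lerDl sumr_ge0.
Qed.

(** On nonnegative reals, zero included, inversion is the power with exponent -1. *)
Lemma measurable_fun_inv_ge0 d (T : measurableType d) (R : realType)
    (f : T -> R) : measurable_fun setT f -> (forall w, 0 <= f w) ->
  measurable_fun setT (fun w => (f w)^-1).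
Proof.
move=> mf f0.
have -> : (fun w => (f w)^-1) = (fun w => f w `^ (-1)).
  by apply/funext => w; rewrite powR_inv1.
exact: measurableT_comp (measurable_powR _) mf.
Qed.

(** Reduces to [n <= 2 ^ n]. It absorbs the factor [n] of the crude bound on the exceptional
    event. *)
Lemma natr_mul_quarter_pow_le (R : realType) (n : nat) : (0 < n)%N ->
  n%:R * (2 * 8^-1) ^+ n <= n%:R^-1 :> R.
Proof.
move=> n0; have n0' : 0 < n%:R :> R by rewrite ltr0n.
have -> : 2 * 8^-1 = (2 ^+ 2)^-1 :> R by field.
rewrite exprVn -exprM mulnC exprM -ler_pdivlMl//.
have -> : n%:R^-1 * n%:R^-1 = (n%:R ^+ 2)^-1 :> R by rewrite -invfM.
rewrite lef_pV2 ?posrE ?exprn_gt0// lerXn2r ?nnegrE ?exprn_ge0//.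
by rewrite -natrX ler_nat ltnW// ltn_expl.
Qed.

(** * Variances of the two ratios for a general one-dimensional law *)

Section iid_ratios.
Context (R : realType) d (T : measurableType d) (P : probability T R).
Context (Q : probability (measurableTypeR R) R) (n : nat) (X : 'I_n -> T -> R).
Context (m s q t : R).
Context (n_gt0 : (0 < n)%N) (mX : forall i, measurable_fun setT (X i)).
Context (iidX : @iid_law R d T _ (measurableTypeR R) P Q n X).
Context (EQ1 : (\int[Q]_x `|x|%:E = m%:E)%E).
Context (EQ2 : (\int[Q]_x (x ^+ 2)%:E = (s ^+ 2)%:E)%E).
Context (EQ4 : (\int[Q]_x (x ^+ 4)%:E = q%:E)%E).
Context (m_gt0 : 0 < m) (le_ms : m <= s) (t_gt0 : 0 < t).
Context (Qsmall : (Q [set x | (`|x| <= 2 * t)%R] <= (8^-1 ^+ 2)%:E)%E).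

Let N : R := n%:R.
Let rn : R := Num.sqrt N.
Let W w := \sum_(i < n) X i w ^+ 2.
Let U w := ell1 X w / N.
Let V w := ell2 X w / rn.

Let s_gt0 : 0 < s. Proof. exact: lt_le_trans le_ms. Qed.
Let N_gt0 : 0 < N. Proof. by rewrite ltr0n. Qed.
Let s_ge0 : 0 <= s. Proof. exact: ltW. Qed.
Let m_ge0 : 0 <= m. Proof. exact: ltW. Qed.
Let t_ge0 : 0 <= t. Proof. exact: ltW. Qed.
Let N_ge0 : 0 <= N. Proof. exact: ltW. Qed.
Let rn_gt0 : 0 < rn. Proof. by rewrite sqrtr_gt0. Qed.
Let rnE : rn ^+ 2 = N. Proof. by rewrite sqr_sqrtr// ltW. Qed.
Let mE : measurable_fun [set: measurableTypeR R] (fun x => `|x| : R).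
Proof. exact: measurableT_comp. Qed.
Let mX2 : measurable_fun [set: measurableTypeR R] (fun x => x ^+ 2 : R).
Proof. exact: (@measurable_funX _ (measurableTypeR R)). Qed.
Let W_ge0 w : 0 <= W w.
Proof. by apply: sumr_ge0 => i _; exact: sqr_ge0. Qed.
Let ell1_ge0 w : 0 <= ell1 X w. Proof. exact: sumr_ge0. Qed.
Let ell2_ge0 w : 0 <= ell2 X w. Proof. exact: sqrtr_ge0. Qed.
Let ell2_sqr w : ell2 X w ^+ 2 = W w.
Proof. exact: (sqr_sqrtr (W_ge0 w)). Qed.
Let U_ge0 w : 0 <= U w. Proof. by rewrite divr_ge0// ltW. Qed.
Let V_ge0 w : 0 <= V w. Proof. by rewrite divr_ge0// ltW. Qed.
Let V_sqr w : V w ^+ 2 = W w / N.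
Proof. by rewrite expr_div_n ell2_sqr rnE. Qed.

Let le_UV w : U w <= V w.
Proof.
rewrite -(@ler_pXn2r _ 2) ?nnegrE// V_sqr expr_div_n ler_pdivrMr ?exprn_gt0//.
have -> : W w / N * N ^+ 2 = N * W w by field; rewrite gt_eqF.
exact: sqr_sum_norm_le.
Qed.

(** The Euclidean norm is at most the l1 norm, and the two normalizations differ by a factor
    [rn]. *)
Let le_VU w : (V w / U w) ^+ 2 <= N.
Proof.
have [U0|Un0] := eqVneq (U w) 0.
  by rewrite U0 invr0 mulr0 expr0n/= ltW.
have Up : 0 < U w by rewrite lt_neqAle eq_sym Un0 U_ge0.
rewrite expr_div_n ler_pdivrMr ?exprn_gt0// V_sqr expr_div_n.
have -> : N * (ell1 X w ^+ 2 / N ^+ 2) = ell1 X w ^+ 2 / N.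
  by field; rewrite gt_eqF.
by rewrite ler_pM2r ?invr_gt0// sum_sqr_le.
Qed.

Let UV_ge0 w : 0 <= U w / V w. Proof. exact: divr_ge0. Qed.
Let VU_ge0 w : 0 <= V w / U w. Proof. exact: divr_ge0. Qed.
Let mell1 : measurable_fun setT (ell1 X).
Proof. by apply: measurable_sum => i; exact: measurableT_comp. Qed.
Let mW : measurable_fun setT W.
Proof. by apply: measurable_sum => i; exact: measurable_funX. Qed.
Let mell2 : measurable_fun setT (ell2 X).
Proof.
apply: (measurableT_comp _ mW).
by apply: continuous_measurable_fun; exact: sqrt_continuous.
Qed.
Let mU : measurable_fun setT U. Proof. exact: measurable_funM. Qed.
Let mV : measurable_fun setT V. Proof. exact: measurable_funM. Qed.
Let mUV : measurable_fun setT (fun w => U w / V w).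
Proof. by apply: measurable_funM => //; exact: measurable_fun_inv_ge0. Qed.
Let mVU : measurable_fun setT (fun w => V w / U w).
Proof. by apply: measurable_funM => //; exact: measurable_fun_inv_ge0. Qed.

Let DU : (\int[P]_w ((U w - m) ^+ 2)%:E <= (s ^+ 2 / N)%:E)%E.
Proof.
apply: (@iid_mean_deviation_le _ _ _ _ _ P Q n X mX iidX (fun x => `|x|)) => //.
by rewrite -EQ2; apply: eq_integral => x _; rewrite real_normK ?num_real.
Qed.

Let DV : (\int[P]_w ((V w ^+ 2 - s ^+ 2) ^+ 2)%:E <= (q / N)%:E)%E.
Proof.
under eq_integral do rewrite V_sqr.
apply: (@iid_mean_deviation_le _ _ _ _ _ P Q n X mX iidX (fun x => x ^+ 2)) => //.
- by move=> x; exact: sqr_ge0.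
- by rewrite -EQ4; apply: eq_integral => x _; rewrite -exprM.
Qed.

Let mDU : measurable_fun setT (fun w => (U w - m) ^+ 2).
Proof. by apply: measurable_funX; exact: measurable_funB. Qed.
Let mDV : measurable_fun setT (fun w => (V w ^+ 2 - s ^+ 2) ^+ 2).
Proof.
by apply: measurable_funX; apply: measurable_funB => //; exact: measurable_funX.
Qed.

Let E1 : ('E_P[ell1 X] = (N * m)%:E)%E.
Proof.
rewrite unlock.
exact: (@iid_ge0_integral_sum _ _ _ _ _ P Q n X mX iidX (fun x => `|x|)).
Qed.

Let EW : (\int[P]_w (W w)%:E = (N * s ^+ 2)%:E)%E.
Proof.
apply: (@iid_ge0_integral_sum _ _ _ _ _ P Q n X mX iidX (fun x => x ^+ 2)) => //.
by move=> x; exact: sqr_ge0.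
Qed.

(** The upper bound is Jensen's inequality, through the tangent to the square at [rn * s]; the lower
    one integrates [ell1 X <= rn * ell2 X], a form of [le_UV]. *)
Let E2 : exists e, [/\ ('E_P[ell2 X] = e%:E)%E, rn * m <= e & e <= rn * s].
Proof.
have up : (\int[P]_w (ell2 X w)%:E <= (rn * s)%:E)%E.
  apply: (@ge0_le_integral_affine _ _ _ P W _ (rn * s / 2) ((2 * rn * s)^-1)
    _ _ mW W_ge0 _ _ EW mell2 ell2_ge0).
  - by rewrite divr_ge0// mulr_ge0// ltW.
  - by rewrite invr_ge0 !mulr_ge0// ltW.
  - move=> w; rewrite -ell2_sqr -subr_ge0.
    have -> : rn * s / 2 + (2 * rn * s)^-1 * ell2 X w ^+ 2 - ell2 X w =
        (ell2 X w - rn * s) ^+ 2 / (2 * rn * s).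
      by field; rewrite !gt_eqF.
    by rewrite divr_ge0 ?sqr_ge0// !mulr_ge0// ltW.
  - rewrite -rnE.
    suff -> : rn * s / 2 + (2 * rn * s)^-1 * (rn ^+ 2 * s ^+ 2) = rn * s by [].
    by field; rewrite !gt_eqF.
have [e [_ eup eE]] := ge0_integral_finE (P := P) ell2_ge0 up.
exists e; split => //; first by rewrite unlock.
have := @ge0_le_integral_affine _ _ _ P (ell2 X) (ell1 X) 0 rn e (rn * e)
  mell2 ell2_ge0 (lexx 0) (ltW rn_gt0) eE mell1 ell1_ge0.
move: E1; rewrite unlock => ->.
rewrite add0r lexx lee_fin -rnE expr2 -mulrA ler_pM2l//; apply => // w.
have := le_UV w; rewrite /U /V add0r ler_pdivrMr// => /le_trans; apply.
by rewrite -rnE expr2 mulrA divfK ?gt_eqF// mulrC.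
Qed.

Lemma iid_variance_ell1_div_ell2 :
  ('V_P[(fun w => normalized P (ell1 X) w / normalized P (ell2 X) w)%R] <=
   ((s ^+ 2 / m ^+ 2 * (2 * q / s ^+ 4 + 2)) / N)%:E)%E.
Proof.
have [e [eE le_e ge_e]] := E2.
(* [k] is the factor between the normalized ratio and [U / V]; [E2] bounds it by [s / m]. *)
pose k := e / (rn * m).
have k_ge0 : 0 <= k by rewrite divr_ge0 ?mulr_ge0 ?(le_trans _ le_e)// ?mulr_ge0 ?ltW.
have k_le : k <= s / m.
  rewrite ler_pdivrMr ?mulr_gt0//.
  suff -> : s / m * (rn * m) = rn * s by [].
  by field; rewrite gt_eqF.
have -> : (fun w => normalized P (ell1 X) w / normalized P (ell2 X) w) =
          (fun w => k * (U w / V w)).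
  apply/funext => w; rewrite /normalized E1 eE /= /U /V !invfM !invrK /k -rnE.
  (* Generalizing the inverse keeps the identity valid where [ell2 X w] vanishes. *)
  by move: (ell2 X w)^-1 => i2; field; rewrite !gt_eqF.
apply: (le_trans (@variance_le_integral_sqr _ _ _ P _ (k * (m / s)) k _ _)).
- exact: measurable_funM.
- move=> w; rewrite normrM (ger0_norm k_ge0) ler_piMr// (ger0_norm (UV_ge0 w)).
  have [->|V0] := eqVneq (V w) 0; first by rewrite invr0 mulr0.
  by rewrite ler_pdivrMr ?mul1r// lt_neqAle eq_sym V0 V_ge0.
(* The coefficients of [sqr_mean_ratio_le], times the bound on [k ^+ 2]. *)
pose c1 := s ^+ 2 / m ^+ 2 * (2 / s ^+ 4).
pose c2 := s ^+ 2 / m ^+ 2 * (2 / s ^+ 2).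
have -> : s ^+ 2 / m ^+ 2 * (2 * q / s ^+ 4 + 2) / N =
    c1 * (q / N) + c2 * (s ^+ 2 / N).
  by rewrite /c1 /c2; field; rewrite !gt_eqF.
apply: (@ge0_le_integral_comb _ _ _ P _ _ _ _ _ _ _ mDV mDU _ _ _ _ _ _ _ DV DU).
- by apply: measurable_funX; apply: measurable_funB => //; exact: measurable_funM.
- by move=> w; exact: sqr_ge0.
- by move=> w; exact: sqr_ge0.
- by move=> w; exact: sqr_ge0.
- by rewrite /c1 !(mulr_ge0, invr_ge0, exprn_ge0).
- by rewrite /c2 !(mulr_ge0, invr_ge0, exprn_ge0).
move=> w; rewrite -mulrBr exprMn /c1 /c2.
rewrite -[X in _ <= X + _]mulrA -[X in _ <= _ + X]mulrA -mulrDr.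
apply: ler_pM; rewrite ?sqr_ge0//.
  by rewrite -expr_div_n lerXn2r ?nnegrE// divr_ge0// ltW.
exact: sqr_mean_ratio_le.
Qed.

Let Bad := [set w | \sum_(i < n) `|X i w| < N * t].
Let mBad : measurable Bad.
Proof.
have -> : Bad = setT `&` ell1 X @^-1` `]-oo, (N * t)%R[.
  by rewrite setTI; apply/seteqP; split=> x /=; rewrite in_itv.
exact: mell1.
Qed.

(** The tail bound with [delta = 1/8], which gives [4 ^- n]. *)
Let PBad : (\int[P]_w (\1_Bad w)%:E <= ((2 * 8^-1) ^+ n)%:E)%E.
Proof.
rewrite integral_indic// setIT.
apply: (@iid_mean_lt_le _ _ _ _ _ P Q n X (fun x => `|x|) t 8^-1) => //.
by rewrite invr_ge0 ler0n/= invf_le1 ?ler1n ?ltr0n.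
Qed.

Lemma iid_variance_ell2_div_ell1 :
  ('V_P[(fun w => normalized P (ell2 X) w / normalized P (ell1 X) w)%R] <=
   ((2 * q / (s ^+ 2 * t ^+ 2) + 2 * s ^+ 4 / (t ^+ 2 * m ^+ 2) +
     s ^+ 2 / m ^+ 2) / N)%:E)%E.
Proof.
have [e [eE le_e ge_e]] := E2.
have e_gt0 : 0 < e by rewrite (lt_le_trans _ le_e)// mulr_gt0.
(* The inverse of the factor for the other ratio; here [rn * m <= e] gives [k <= 1]. *)
pose k := rn * m / e.
have k_ge0 : 0 <= k by rewrite divr_ge0 ?mulr_ge0 ?ltW.
have k_le : k <= 1 by rewrite ler_pdivrMr// mul1r.
have -> : (fun w => normalized P (ell2 X) w / normalized P (ell1 X) w) =
          (fun w => k * (V w / U w)).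
  apply/funext => w; rewrite /normalized E1 eE /= /U /V !invfM !invrK /k -rnE.
  by move: (ell1 X w)^-1 => i1; field; rewrite !gt_eqF.
have N_ge1 : 1 <= N by rewrite ler1n.
(* The uniform bound [N] comes from [V / U <= rn <= N]. *)
apply: (le_trans (@variance_le_integral_sqr _ _ _ P _ (k * (s / m)) N _ _)).
- exact: measurable_funM.
- move=> w; rewrite normrM (ger0_norm k_ge0) (ger0_norm (VU_ge0 w)).
  apply: (@le_trans _ _ (V w / U w)); first by rewrite ler_piMl.
  rewrite -(@ler_pXn2r _ 2) ?nnegrE ?(ltW N_gt0)//.
  by rewrite (le_trans (le_VU w))// expr2 ler_peMl// ltW.
pose a := 2 / (s ^+ 2 * t ^+ 2).
pose b := 2 * s ^+ 2 / (t ^+ 2 * m ^+ 2).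
pose c := N * (s ^+ 2 / m ^+ 2).
have a_ge0 : 0 <= a by rewrite !(mulr_ge0, invr_ge0, exprn_ge0).
have b_ge0 : 0 <= b by rewrite !(mulr_ge0, invr_ge0, exprn_ge0).
have c_ge0 : 0 <= c by rewrite !(mulr_ge0, invr_ge0, exprn_ge0).
(* Three contributions: the deviation of [V ^+ 2], the deviation of [U], and the event [Bad]. *)
apply: (@le_trans _ _
    (a * (q / N) + 1 * (b * (s ^+ 2 / N) + c * (2 * 8^-1) ^+ n))%:E); last first.
  rewrite lee_fin mul1r.
  have -> : (2 * q / (s ^+ 2 * t ^+ 2) + 2 * s ^+ 4 / (t ^+ 2 * m ^+ 2) +
      s ^+ 2 / m ^+ 2) / N =
    a * (q / N) + (b * (s ^+ 2 / N) + s ^+ 2 / m ^+ 2 * N^-1).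
    by rewrite /a /b; field; rewrite !gt_eqF.
  rewrite !lerD2l /c [N * _]mulrC -[leLHS]mulrA ler_wpM2l//.
    by rewrite divr_ge0 ?exprn_ge0.
  exact: natr_mul_quarter_pow_le.
have mI : measurable_fun setT (\1_Bad : T -> R) by exact: measurable_indic.
have I0 w : 0 <= \1_Bad w :> R by [].
pose g2 w := b * (U w - m) ^+ 2 + c * \1_Bad w.
have DU0 w : 0 <= (U w - m) ^+ 2 by exact: sqr_ge0.
have DV0 w : 0 <= (V w ^+ 2 - s ^+ 2) ^+ 2 by exact: sqr_ge0.
have g20 w : 0 <= g2 w by rewrite addr_ge0// mulr_ge0.
have mg2 : measurable_fun setT g2.
  by apply: measurable_funD; exact: measurable_funM.
have ig2 : (\int[P]_w (g2 w)%:E <=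
    (b * (s ^+ 2 / N) + c * (2 * 8^-1) ^+ n)%:E)%E.
  exact: (@ge0_le_integral_comb _ _ _ P _ _ _ _ _ _ _ mDU mI _ _ _ _ _ _ _ DU PBad).
apply: (@ge0_le_integral_comb _ _ _ P _ _ _ _ _ _ _ mDV mg2 _ _ _ _ _ _ _ DV ig2) => //.
- by apply: measurable_funX; apply: measurable_funB => //; exact: measurable_funM.
- by move=> w; exact: sqr_ge0.
move=> w; rewrite -mulrBr exprMn mul1r.
apply: (@le_trans _ _ ((V w / U w - s / m) ^+ 2)).
  by rewrite ler_piMl ?sqr_ge0// exprn_ile1.
(* On [Bad] the crude bound is covered by the indicator term alone; elsewhere the two deviations
   suffice. *)
rewrite /g2 addrA indicE; have [Ut|tU] := ltP (U w) t.
  have -> : w \in Bad by rewrite inE /Bad /= -ltr_pdivrMl// mulrC.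
  rewrite mulr1 -[leLHS]add0r lerD//.
    by rewrite addr_ge0// mulr_ge0.
  exact: sqr_inv_mean_ratio_le_crude.
apply: (@le_trans _ _ (a * (V w ^+ 2 - s ^+ 2) ^+ 2 + b * (U w - m) ^+ 2)).
  exact: sqr_inv_mean_ratio_le.
by rewrite lerDl mulr_ge0.
Qed.

End iid_ratios.

(** * Numerical constants and the Gaussian case *)

(** Here [k] is [c ^+ 2]. Each quotient is homogeneous of degree 0 in the scale, so the powers of
    two bounding them are independent of [c]. *)
Lemma normal_ratio_constants_le (R : realType) (k t m v q : R) :
  0 < k -> 0 < t -> t ^+ 2 = k / 2 ^+ 14 -> k / 16 <= m ^+ 2 -> m ^+ 2 <= v ->
  v <= 33 * k -> 0 <= q -> q <= 64 * k ^+ 2 ->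
  v / m ^+ 2 * (2 * q / v ^+ 2 + 2) <= 2 ^+ 32 /\
  2 * q / (v * t ^+ 2) + 2 * v ^+ 2 / (t ^+ 2 * m ^+ 2) + v / m ^+ 2 <= 2 ^+ 32.
Proof.
move=> k0 t0 tE km mv vk q0 qk.
have k16 : 0 < k / 16 by rewrite divr_gt0.
have m0 : 0 < m ^+ 2 by exact: lt_le_trans km.
have v0 : 0 < v by exact: lt_le_trans mv.
have t20 : 0 < t ^+ 2 by rewrite exprn_gt0.
have kn0 : k != 0 by rewrite gt_eqF.
have kv : k / 16 <= v by exact: le_trans mv.
have A : v / m ^+ 2 <= 2 ^+ 10.
  rewrite ler_pdivrMr// (le_trans vk)//.
  apply: (@le_trans _ _ (2 ^+ 10 * (k / 16))); last by rewrite ler_wpM2l ?exprn_ge0.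
  lra.
have B : q / v ^+ 2 <= 2 ^+ 14.
  rewrite ler_pdivrMr ?exprn_gt0// (le_trans qk)//.
  have -> : 64 * k ^+ 2 = 2 ^+ 14 * (k / 16) ^+ 2 by field.
  by rewrite ler_wpM2l ?exprn_ge0// lerXn2r ?nnegrE ?(ltW k16) ?(ltW v0).
have D : q / (v * t ^+ 2) <= 2 ^+ 24.
  rewrite ler_pdivrMr ?mulr_gt0// (le_trans qk)// tE.
  have -> : 64 * k ^+ 2 = 2 ^+ 24 * (k / 16 * (k / 2 ^+ 14)) by field.
  by rewrite ler_wpM2l ?exprn_ge0// ler_wpM2r// -tE ltW.
have F : v / t ^+ 2 <= 2 ^+ 20.
  rewrite ler_pdivrMr// (le_trans vk)// tE.
  have -> : 2 ^+ 20 * (k / 2 ^+ 14) = 64 * k by field.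
  lra.
have A0 : 0 <= v / m ^+ 2 by rewrite divr_ge0// ltW.
have B0 : 0 <= q / v ^+ 2 by rewrite divr_ge0// exprn_ge0// ltW.
have F0 : 0 <= v / t ^+ 2 by rewrite divr_ge0// ltW.
have -> : 2 * v ^+ 2 / (t ^+ 2 * m ^+ 2) = 2 * (v / t ^+ 2 * (v / m ^+ 2)).
  by field; rewrite -[m == 0]sqrf_eq0 !gt_eqF.
rewrite -!(mulrA 2); split.
  apply: (@le_trans _ _ (2 ^+ 10 * (2 * 2 ^+ 14 + 2))); last by lra.
  by apply: ler_pM => //; [rewrite addr_ge0// mulr_ge0|lra].
(* Doubled, this is the dominant term [2 ^+ 31], whence the final [2 ^+ 32]. *)
have : v / t ^+ 2 * (v / m ^+ 2) <= 2 ^+ 20 * 2 ^+ 10 by apply: ler_pM.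
lra.
Qed.

Theorem theorem2 (R : realType) :
  exists C : R, 0 < C /\
  forall (n : nat) (c : R) (d : measure_display) (T : measurableType d)
         (P : probability T R) (X : 'I_n -> {RV P >-> R}),
    (1 <= n)%N -> c != 0 ->
    @isotropic_gaussian R d T P n c X ->
    let l1h := normalized P (ell1 (fun i => X i : T -> R)) in
    let l2h := normalized P (ell2 (fun i => X i : T -> R)) in
    (maxe ('V_P[(fun w => l2h w / l1h w)%R]) ('V_P[(fun w => l1h w / l2h w)%R])
      <= (C / n%:R)%:E)%E.
Proof.
exists (2 ^+ 32); split; first exact: exprn_gt0.
move=> n c d T P X n1 c0 gX; cbv zeta.
have n0 : 0 < n%:R :> R by rewrite ltr0n.
have [m [v [q [E1 E2 E4 mc [mv vc qc]]]]] := normal_moments c0.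
have nc : 0 < `|c| by rewrite normr_gt0.
have m0 : 0 < m by rewrite (lt_le_trans _ mc)// divr_gt0.
have v0 : 0 < v by rewrite (lt_le_trans _ mv)// exprn_gt0.
pose s := Num.sqrt v.
have sE : s ^+ 2 = v by rewrite sqr_sqrtr// ltW.
have ms : m <= s by rewrite -(@ler_pXn2r _ 2) ?nnegrE ?sqrtr_ge0 ?(ltW m0)// sE.
(* Chosen so that [2 * t / |c|], the bound on the mass of [[-2t, 2t]], equals [2 ^- 6], the square
   of 1/8. *)
pose t := `|c| / 2 ^+ 7.
have t0 : 0 < t by rewrite divr_gt0// exprn_gt0.
have c2E : `|c| ^+ 2 = c ^+ 2 by rewrite real_normK ?num_real.
have tE : t ^+ 2 = c ^+ 2 / 2 ^+ 14 by rewrite expr_div_n c2E -exprM.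
have Qs : (normal_prob 0 c [set x | (`|x| <= 2 * t)%R] <= (8^-1 ^+ 2)%:E)%E.
  have -> : [set x : R | `|x| <= 2 * t] = `[(- (2 * t))%R, (2 * t)%R]%classic.
    by apply/seteqP; split=> x /=; rewrite in_itv/= ler_norml.
  have -> : 8^-1 ^+ 2 = 2 * t / `|c| by rewrite /t; field; rewrite gt_eqF.
  by apply: normal_prob_itv_le => //; rewrite mulr_ge0// ltW.
have q0 : 0 <= q.
  rewrite -lee_fin -E4; apply: integral_ge0 => x _.
  by rewrite lee_fin exprn_even_ge0.
have km : c ^+ 2 / 16 <= m ^+ 2.
  have -> : c ^+ 2 / 16 = (`|c| / 4) ^+ 2 by rewrite expr_div_n c2E; field.
  by rewrite lerXn2r ?nnegrE ?divr_ge0 ?(ltW m0).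
have qc' : q <= 64 * (c ^+ 2) ^+ 2 by rewrite -exprM.
have c2 : 0 < c ^+ 2 by rewrite exprn_even_gt0.
have [K1 K2] := normal_ratio_constants_le c2 t0 tE km mv vc q0 qc'.
have s4 : s ^+ 4 = v ^+ 2 by rewrite -sE -exprM.
have mX i : measurable_fun setT (X i : T -> R) by [].
rewrite -sE in E2.
have h1 := @iid_variance_ell1_div_ell2 R d T P (normal_prob 0 c) n
  (fun i => X i) m s q n1 mX gX E1 E2 E4 m0 ms.
have h2 := @iid_variance_ell2_div_ell1 R d T P (normal_prob 0 c) n
  (fun i => X i) m s q t n1 mX gX E1 E2 E4 m0 ms t0 Qs.
rewrite ge_max; apply/andP; split.
  apply: (le_trans h2); rewrite lee_fin ler_pM2r ?invr_gt0//.
  by rewrite sE s4.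
by apply: (le_trans h1); rewrite lee_fin ler_pM2r ?invr_gt0// sE s4.
Qed.
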